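(* Let $R$ be a ring, $p$ be a nonnegative integer and $\mathbf F$ be an $F$-totally acyclic complex of flat $R$-modules $F_i$ ($i\in\mathbb Z$) such that $\operatorname{pd}_RF_i\le p$ for every $i\in\mathbb Z$. Then every syzygy module $Z_i=\ker(F_i\to F_{i-1})$ of the complex $\mathbf F$ satisfies $\operatorname{PGF-dim}_RZ_i\le p$, $i\in\mathbb Z$. Moreover, for every $i\in\mathbb Z$, there exists an exact sequence $$0\to X\to Q_{p-1}\to\cdots\to Q_0\to Z_i\to0$$ in which $X$ is PGF and each $Q_j$ is projective.
   Context: Rings are associative with unit and modules are left modules unless stated otherwise; $\operatorname{pd}$ denotes projective dimension. An acyclic ($\mathbb{Z}$-indexed, homologically graded) complex $\mathbf F$ of flat $R$-modules is $F$-totally acyclic if $I\otimes_R\mathbf F$ is acyclic for every injective right $R$-module $I$. A module is projectively coresolved Gorenstein flat (PGF) if it is a cycle of an acyclic complex $\mathbf P$ of projective $R$-modules such that $I\otimes_R\mathbf P$ is acyclic for every injective right $R$-module $I$. The PGF-dimension $\operatorname{PGF-dim}_RM$ is the least $n\ge0$ for which there is an exact sequence $0\to X_n\to\cdots\to X_0\to M\to0$ with all $X_i$ PGF, and $\infty$ if there is no such $n$. *)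

(* Defs.v *)
From HB Require Import structures.
From mathcomp Require Import all_boot all_algebra.
From mathcomp Require Import boolp freeg.

Set Implicit Arguments.
Unset Strict Implicit.
Unset Printing Implicit Defensive.

Import GRing.Theory.
Local Open Scope ring_scope.

(* Rings are [pzRingType]s, so the zero ring is allowed.  Left R-modules are
   [lmodType R]; right R-modules are [lmodType R^c], with x r written r *: x. *)

Definition is_exact (U V W : zmodType) (f : U -> V) (g : V -> W) : Prop :=
  forall y, g y = 0 <-> exists x, f x = y.

Definition kernel (R : pzRingType) (U V : lmodType R) (f : {linear U -> V}) :
  {pred U} := [pred x | f x == 0].

Section Kernel.
Variables (R : pzRingType) (U V : lmodType R) (f : {linear U -> V}).

Fact kernel_submod_closed : submod_closed (kernel f).
Proof.
split=> [|a x y]; rewrite !inE ?linear0 // => /eqP fx /eqP fy.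
by rewrite linearP fx fy scaler0 addr0.
Qed.

HB.instance Definition _ :=
  GRing.isSubmodClosed.Build R U (kernel f) kernel_submod_closed.

Record ker_type : Type := Ker { ker_val : U; _ : ker_val \in kernel f }.

HB.instance Definition _ := [isSub for ker_val].
HB.instance Definition _ := [Choice of ker_type by <:].
HB.instance Definition _ := [SubChoice_isSubLmodule of ker_type by <:].

End Kernel.

Section TensorProduct.
Variable R : pzRingType.

Inductive tensor_relation (N : lmodType R^c) (M : lmodType R) :
    {freeg (N * M) / int} -> Prop :=
| TensorAddl x x' y :
    tensor_relation (<< (x + x', y) >> - << (x, y) >> - << (x', y) >>)
| TensorAddr x y y' :
    tensor_relation (<< (x, y + y') >> - << (x, y) >> - << (x, y') >>)
| TensorScale (r : R) x y :
    tensor_relation (<< ((r : R^c) *: x, y) >> - << (x, r *: y) >>).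

Section Construction.
Variables (N : lmodType R^c) (M : lmodType R).

(* The smallest subgroup containing the relations. *)
Definition tensor_rel : {pred {freeg (N * M) / int}} :=
  [pred D | `[< forall S : {pred {freeg (N * M) / int}}, zmod_closed S ->
                (forall E, tensor_relation E -> E \in S) -> D \in S >]].

Fact tensor_rel_zmod_closed : zmod_closed tensor_rel.
Proof.
split=> [|D E]; rewrite !inE; first by apply/asboolP => S [].
move=> /asboolP hD /asboolP hE; apply/asboolP => S cS rS.
by apply: cS.2; [apply: hD | apply: hE].
Qed.

HB.instance Definition _ :=
  GRing.isZmodClosed.Build _ tensor_rel tensor_rel_zmod_closed.

Definition tensor : zmodType := Quotient.quot tensor_rel.

Definition tensor_pi (D : {freeg (N * M) / int}) : tensor :=
  \pi_(Quotient.quot tensor_rel)%qT D.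

Definition tens (x : N) (y : M) : tensor := tensor_pi << (x, y) >>.

End Construction.

Definition tensor_map (N N' : lmodType R^c) (M M' : lmodType R)
    (f : N -> N') (g : M -> M') (t : tensor N M) : tensor N' M' :=
  tensor_pi (fglift (fun z : N * M => << (f z.1, g z.2) >>) (repr t)).

End TensorProduct.

Section TensorTheory.
Variables (R : pzRingType) (N : lmodType R^c) (M : lmodType R).

Fact tensor_pi_is_zmod_morphism : zmod_morphism (@tensor_pi R N M).
Proof. exact: raddfB. Qed.
HB.instance Definition _ :=
  GRing.isZmodMorphism.Build _ _ (@tensor_pi R N M) tensor_pi_is_zmod_morphism.

Lemma tensor_piB (D E : {freeg (N * M) / int}) :
  tensor_pi (D - E) = tensor_pi D - tensor_pi E.
Proof. exact: raddfB. Qed.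

Lemma tensor_piK (t : tensor N M) : tensor_pi (repr t) = t.
Proof. exact: reprK. Qed.

Lemma tensor_pi_eq0 (D : {freeg (N * M) / int}) :
  (tensor_pi D == 0) = (D \in @tensor_rel R N M).
Proof. by rewrite -[0](raddf0 (@tensor_pi R N M)) -Quotient.idealrBE subr0. Qed.

Lemma tensDl x x' (y : M) : tens (x + x') y = tens x y + tens x' y :> tensor N M.
Proof.
apply/eqP; rewrite -subr_eq0 opprD addrA -!raddfB tensor_pi_eq0 inE.
by apply/asboolP => S _; apply; apply: TensorAddl.
Qed.

Lemma tensDr x (y y' : M) : tens x (y + y') = tens x y + tens x y' :> tensor N M.
Proof.
apply/eqP; rewrite -subr_eq0 opprD addrA -!raddfB tensor_pi_eq0 inE.
by apply/asboolP => S _; apply; apply: TensorAddr.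
Qed.

Lemma tensZ (r : R) x (y : M) : tens ((r : R^c) *: x) y = tens x (r *: y) :> tensor N M.
Proof.
apply/eqP; rewrite -subr_eq0 -!raddfB tensor_pi_eq0 inE.
by apply/asboolP => S _; apply; apply: TensorScale.
Qed.

(* Universal property: balanced biadditive maps factor through [tens]. *)
Lemma tensor_lift (A : zmodType) (b : N -> M -> A) :
    (forall x x' y, b (x + x') y = b x y + b x' y) ->
    (forall x y y', b x (y + y') = b x y + b x y') ->
    (forall (r : R) x y, b ((r : R^c) *: x) y = b x (r *: y)) ->
  exists h : {additive tensor N M -> A},
    [/\ forall x y, h (tens x y) = b x y
      & forall D, h (tensor_pi D) = fglift (fun z : N * M => b z.1 z.2 : zmodule A) D].
Proof.
move=> bDl bDr bZ.
pose L : {freeg (N * M) / int} -> A :=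
  fglift (fun z : N * M => b z.1 z.2 : zmodule A).
have LB (D E : {freeg (N * M) / int}) : L (D - E) = L D - L E by apply: (lift_is_additive (M := zmodule A)).
have L00 : L 0 = 0 by have := LB 0 0; rewrite !subrr.
have LU z : L << z >> = b z.1 z.2 by rewrite /L liftU scale1r.
have L0 D : D \in @tensor_rel R N M -> L D = 0.
  rewrite inE => /asboolP/(_ [pred D | L D == 0]) h.
  apply/eqP; apply: h.
    split=> [|D' E']; rewrite !inE; first by rewrite L00.
    by rewrite LB => /eqP -> /eqP ->; rewrite subrr.
  move=> _ [x x' y|x y y'|r x y]; rewrite inE !LB !LU /=.
  - by rewrite bDl addrAC addrK subrr.
  - by rewrite bDr addrAC addrK subrr.
  - by rewrite bZ subrr.
pose h (t : tensor N M) : A := L (repr t).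
have hpi D : h (tensor_pi D) = L D.
  apply/eqP; rewrite -subr_eq0 -LB L0 // -tensor_pi_eq0.
  by rewrite tensor_piB tensor_piK subrr.
have hB : zmod_morphism h.
  move=> t u; apply/eqP; rewrite -subr_eq0 /h -!LB L0 // -tensor_pi_eq0.
  by rewrite !tensor_piB !tensor_piK subrr.
pose H : {additive tensor N M -> A} :=
  HB.pack h (GRing.isZmodMorphism.Build _ _ h hB).
exists H; split=> [x y|D]; last exact: hpi.
by rewrite /= /tens hpi LU.
Qed.

Lemma tensor_additive_ext (A : zmodType) (h k : {additive tensor N M -> A}) :
  (forall x y, h (tens x y) = k (tens x y)) -> h =1 k.
Proof.
move=> hk t; rewrite -[t]tensor_piK.
rewrite -(freeg_sumE (repr t)) !raddf_sum; apply: eq_bigr => -[x y] _.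
rewrite -[coeff _ _]intz -freegU_mulz !raddfMz.
by rewrite [h _]hk.
Qed.

End TensorTheory.

Section TensorMapTheory.
Variables (R : pzRingType) (N N' : lmodType R^c) (M M' : lmodType R).
Variables (f : {linear N -> N'}) (g : {linear M -> M'}).

Lemma tensor_mapP : exists h : {additive tensor N M -> tensor N' M'},
  h =1 tensor_map f g /\ forall x y, h (tens x y) = tens (f x) (g y).
Proof.
have [||r x y|h [hE hpi]] :=
    @tensor_lift R N M (tensor N' M') (fun x y => tens (f x) (g y)).
- by move=> x x' y; rewrite raddfD tensDl.
- by move=> x y y'; rewrite raddfD tensDr.
- by rewrite !linearZ tensZ.
exists h; split=> // t.
rewrite -[t in LHS]tensor_piK hpi /tensor_map -(Freeg_enum (repr t)).
rewrite !fglift_Freeg /prelift raddf_sum; apply: eq_bigr => z _.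
by rewrite -[in RHS](intz z.1) scaler_int raddfMz scalezrE.
Qed.

Fact tensor_map_is_zmod_morphism : zmod_morphism (tensor_map f g).
Proof. by have [h [hE _]] := tensor_mapP => x y; rewrite -!hE raddfB. Qed.

HB.instance Definition _ := GRing.isZmodMorphism.Build _ _ (tensor_map f g)
  tensor_map_is_zmod_morphism.

Lemma tensor_map_tens x y : tensor_map f g (tens x y) = tens (f x) (g y).
Proof. by have [h [hE <-]] := tensor_mapP; rewrite hE. Qed.

End TensorMapTheory.

Section Modules.
Variable R : pzRingType.

Definition is_projective (P : lmodType R) : Prop :=
  forall (U V : lmodType R) (g : {linear U -> V}) (f : {linear P -> V}),
    (forall v, exists u, g u = v) ->
  exists h : {linear P -> U}, forall x, g (h x) = f x.

Definition is_injective (I : lmodType R) : Prop :=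
  forall (U V : lmodType R) (g : {linear U -> V}) (f : {linear U -> I}),
    injective g ->
  exists h : {linear V -> I}, forall x, h (g x) = f x.

Definition is_flat (M : lmodType R) : Prop :=
  forall (A B C : lmodType R^c) (f : {linear A -> B}) (g : {linear B -> C}),
    is_exact f g ->
  is_exact (tensor_map f (@idfun M)) (tensor_map g (@idfun M)).

End Modules.

Section Complexes.
Variable R : pzRingType.

(* The differential C_i -> C_j is indexed by a proof of i = j + 1, which avoids
   casts between C_(i - 1 + 1) and C_i. *)
Record complex : Type := Complex {
  obj :> int -> lmodType R;
  diff : forall i j : int, i = j + 1 -> {linear obj i -> obj j};
  diff_diff : forall (i j k : int) (ij : i = j + 1) (jk : j = k + 1) x,
    diff jk (diff ij x) = 0
}.

Definition cycles (C : complex) (i : int) : lmodType R :=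
  ker_type (diff C (esym (subrK 1 i) : i = (i - 1) + 1)).

Definition acyclic (C : complex) : Prop :=
  forall (i j k : int) (ij : i = j + 1) (jk : j = k + 1),
    is_exact (diff C ij) (diff C jk).

Definition tensor_acyclic (N : lmodType R^c) (C : complex) : Prop :=
  forall (i j k : int) (ij : i = j + 1) (jk : j = k + 1),
    is_exact (tensor_map (@idfun N) (diff C ij)) (tensor_map (@idfun N) (diff C jk)).

Definition F_totally_acyclic (F : complex) : Prop :=
  [/\ forall i, is_flat (F i), acyclic F
    & forall I : lmodType R^c, is_injective I -> tensor_acyclic I F].

Definition is_PGF (M : lmodType R) : Prop :=
  exists P : complex,
    [/\ forall i, is_projective (P i), acyclic P,
        forall I : lmodType R^c, is_injective I -> tensor_acyclic I P
      & exists (i : int) (f : {linear M -> cycles P i}), bijective f].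

End Complexes.

Section Dimensions.
Variable R : pzRingType.

(* [resolution n X d e] states exactness of
   0 -> X_n -> ... -> X_0 -> M -> 0, the family X being extended by zero above
   n; injectivity of X_n -> X_(n-1) is exactness at X_n. *)
Definition resolution (n : nat) (M : lmodType R) (X : nat -> lmodType R)
    (d : forall k, {linear X k.+1 -> X k}) (e : {linear X 0%N -> M}) : Prop :=
  [/\ forall y, exists x, e x = y,
      is_exact (d 0%N) e,
      forall k, is_exact (d k.+1) (d k)
    & forall k, (n < k)%N -> forall x : X k, x = 0].

Definition has_resolution (P : lmodType R -> Prop) (M : lmodType R) (n : nat) :
    Prop :=
  exists (X : nat -> lmodType R) (d : forall k, {linear X k.+1 -> X k})
         (e : {linear X 0%N -> M}),
    resolution n d e /\ forall k, (k <= n)%N -> P (X k).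

(* [None] stands for infinity. *)
Definition least (P : nat -> Prop) : option nat :=
  if pselect (exists n, `[< P n >]) is left h then Some (ex_minn h) else None.

Definition dim_le (d : option nat) (p : nat) : Prop :=
  if d is Some n then (n <= p)%N else False.

Definition pd (M : lmodType R) : option nat :=
  least (has_resolution (@is_projective R) M).

Definition PGF_dim (M : lmodType R) : option nat :=
  least (has_resolution (@is_PGF R) M).

End Dimensions.

(* Main.v *)
From HB Require Import structures.
Require Import Defs.
From mathcomp Require Import all_boot all_algebra.
From mathcomp Require Import boolp functions freeg.

Set Implicit Arguments.
Unset Strict Implicit.
Unset Printing Implicit Defensive.

Import GRing.Theory.
Local Open Scope ring_scope.

(** Cover [F] by the simplest complex that surjects onto it: take one projective
    module [P] with epimorphisms [g i : P -> F i] for all [i], and let [Q] be the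
    complex with [Q_i = P * P] and differential [(a, b) |-> (0, a)], a direct sum
    of disks.  The maps [g i] on the disks form an epimorphism of complexes
    [Q -> F]; let [K] be its kernel ([cover_kernel]).

    [Q] is contractible, so it is acyclic and stays so under every tensor
    product.  As each [F i] is flat, [0 -> K -> Q -> F -> 0] remains exact under
    [I (x) -], and a diagram chase ([exact_kernel_complex]) shows that [K] is
    again an F-totally acyclic complex of flat modules.  By Schanuel's lemma the
    projective dimensions of its terms are at most [p - 1] when those of [F] are
    at most [p].  The cycles of [Q] are copies of [P], so there are exact
    sequences [0 -> Z_i K -> P -> Z_i F -> 0] ([cover_cycles]).  Induction on [p]
    therefore resolves [Z_i F] by projectives for [p] steps, and what is left is a
    cycle of an F-totally acyclic complex of projectives, that is, a PGF module.
    The bound on the PGF-dimension follows because projective modules are PGF,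
    being cycles of disk complexes ([projective_PGF]).

    Two ingredients are proved from the definitions.  For tensor products:
    right exactness ([tensor_map_kernel]), flatness of projectives via dual bases
    ([projective_flat]), and the vanishing of Tor_1(N, F) for flat [F] in the form
    that [N (x) -] preserves the monomorphism of a short exact sequence ending in
    [F] ([flat_quotient_tensor_injective]).  For projective dimension: a version of
    Schanuel's lemma for retracts ([schanuel_retract]), from which independence of
    the chosen syzygies follows without Ext ([pd_le_syzygy]). *)

(** * Linear maps, kernels and exactness *)

Definition surjective (U V : Type) (g : U -> V) := forall v, exists u, g u = v.

Definition short_exact (U V W : zmodType) (f : U -> V) (g : V -> W) : Prop :=
  [/\ injective f, is_exact f g & surjective g].

Section LinearMaps.
Variable S : pzRingType.

Definition linear_of (U V : lmodType S) (f : U -> V) (fL : linear f) :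
  {linear U -> V} := HB.pack f (GRing.isLinear.Build S U V *:%R f fL).

Section Pairs.
Variables U V : lmodType S.

Fact inl_is_linear : linear (fun x : U => (x, 0) : U * V).
Proof. by move=> a x y; congr (_, _); rewrite /= scaler0 addr0. Qed.
Definition linear_inl := linear_of inl_is_linear.

Fact inr_is_linear : linear (fun y : V => (0, y) : U * V).
Proof. by move=> a x y; congr (_, _); rewrite /= scaler0 addr0. Qed.
Definition linear_inr := linear_of inr_is_linear.

Fact fst_is_linear : linear (fst : U * V -> U). Proof. by []. Qed.
Definition linear_fst := linear_of fst_is_linear.

Fact snd_is_linear : linear (snd : U * V -> V). Proof. by []. Qed.
Definition linear_snd := linear_of snd_is_linear.

End Pairs.

Section KernelMaps.
Variables (U V : lmodType S) (f : {linear U -> V}).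

Fact ker_incl_is_linear : linear (val : ker_type f -> U).
Proof. by move=> a x y; rewrite linearP. Qed.
Definition ker_incl := linear_of ker_incl_is_linear.

Lemma ker_inclK x : f (ker_incl x) = 0.
Proof. by apply/eqP; exact: (valP x). Qed.

Lemma ker_incl_inj : injective ker_incl.
Proof. exact: val_inj. Qed.

Lemma ker_incl_exact : is_exact ker_incl f.
Proof.
move=> y; split=> [fy|[x <-]]; last exact: ker_inclK.
have ky : y \in kernel f by rewrite inE fy.
by exists (Ker ky).
Qed.

Variables (W : lmodType S) (h : {linear W -> U}) (fh : forall w, f (h w) = 0).

Fact corestrict_subproof w : h w \in kernel f.
Proof. by rewrite inE fh. Qed.

Fact corestrict_is_linear :
  linear (fun w => Ker (corestrict_subproof w) : ker_type f).
Proof. by move=> a x y; apply: ker_incl_inj; rewrite [RHS]linearP /=; exact: linearP. Qed.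

Definition corestrict : {linear W -> ker_type f} :=
  linear_of corestrict_is_linear.

Lemma ker_incl_corestrict w : ker_incl (corestrict w) = h w.
Proof. by []. Qed.

End KernelMaps.

Lemma ker_short_exact (U V : lmodType S) (f : {linear U -> V}) :
  surjective f -> short_exact (ker_incl f) f.
Proof. by move=> fS; split=> //; exact: ker_incl_exact. Qed.

(** Universal property of the kernel for an arbitrary kernel inclusion [j]. *)
Lemma lift_along_kernel (K Q M W : lmodType S) (j : {linear K -> Q})
    (g : {linear Q -> M}) (h : {linear W -> Q}) :
  injective j -> is_exact j g -> (forall w, g (h w) = 0) ->
  exists k : {linear W -> K}, forall w, j (k w) = h w.
Proof.
move=> jI jg gh.
have /choice[k kE] : forall w, exists x, j x = h w by move=> w; apply/jg.
have kL : linear k by move=> a x y; apply: jI; rewrite linearP !kE linearP.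
by exists (linear_of kL).
Qed.

End LinearMaps.

(** The long exact homology sequence of [0 -> K -> Q -> F -> 0] forces [K] to be
    exact where [Q] and [F] are.  Exactness of [K] in one degree involves only the
    degrees numbered 3 to 0 here, and short exactness of only some columns, so the
    lemma also serves for rows that do not come from a whole complex, as in
    [flat_kernel]. *)
Lemma exact_kernel_complex (K2 K1 K0 Q3 Q2 Q1 Q0 F3 F2 F1 : zmodType)
    (k2 : {additive K2 -> K1}) (k1 : {additive K1 -> K0})
    (q3 : {additive Q3 -> Q2}) (q2 : {additive Q2 -> Q1})
    (q1 : {additive Q1 -> Q0})
    (f3 : {additive F3 -> F2}) (f2 : {additive F2 -> F1})
    (j2 : {additive K2 -> Q2}) (j1 : {additive K1 -> Q1})
    (j0 : {additive K0 -> Q0})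
    (s3 : {additive Q3 -> F3}) (s2 : {additive Q2 -> F2})
    (s1 : {additive Q1 -> F1}) :
  is_exact q2 q1 -> is_exact f3 f2 -> (forall x, q2 (q3 x) = 0) ->
  (forall x, q2 (j2 x) = j1 (k2 x)) -> (forall x, q1 (j1 x) = j0 (k1 x)) ->
  (forall x, f3 (s3 x) = s2 (q3 x)) -> (forall x, f2 (s2 x) = s1 (q2 x)) ->
  injective j0 -> injective j1 -> is_exact j2 s2 ->
  (forall x, s1 (j1 x) = 0) -> surjective s3 ->
  is_exact k2 k1.
Proof.
move=> q21 f32 q23 qj2 qj1 fs3 fs2 j0I j1I js2 sj1 s3S y; split=> [ky|[x <-]].
  have /q21[x xE] : q1 (j1 y) = 0 by rewrite qj1 ky raddf0.
  have /f32[z zE] : f2 (s2 x) = 0 by rewrite fs2 xE sj1.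
  have [w wE] := s3S z.
  have /js2[t tE] : s2 (x - q3 w) = 0 by rewrite raddfB -fs3 wE zE subrr.
  by exists t; apply: j1I; rewrite -qj2 tE raddfB q23 subr0.
apply: j0I; rewrite raddf0 -qj1 -qj2; apply/q21; by exists (j2 x).
Qed.

(** * Free modules and dual bases *)

Section FreeModule.
Variables (S : pzRingType) (X : eqType).

Definition finitely_supported : {pred (X -> S^o)} :=
  [pred f | `[< exists s : seq X, forall x, x \notin s -> f x = 0 >]].

Fact finitely_supported_submod_closed : submod_closed finitely_supported.
Proof.
split=> [|a f g]; rewrite !inE; first by apply/asboolP; exists [::].
move=> /asboolP[s fs] /asboolP[t gt]; apply/asboolP; exists (s ++ t) => x.
rewrite mem_cat negb_or => /andP[xs xt].
rewrite [LHS]/(a *: f x + g x) fs // gt // scaler0; exact: addr0.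
Qed.

HB.instance Definition _ := GRing.isSubmodClosed.Build S (X -> S^o)
  finitely_supported finitely_supported_submod_closed.

Record free_module : Type :=
  FreeModule { fun_of_free : X -> S^o; _ : fun_of_free \in finitely_supported }.

HB.instance Definition _ := [isSub for fun_of_free].
HB.instance Definition _ := [Choice of free_module by <:].
HB.instance Definition _ := [SubChoice_isSubLmodule of free_module by <:].

Definition coord (x : X) (u : free_module) : S := val u x.

Fact coord_is_linear (x : X) :
  linear (coord x : free_module -> S^o).
Proof. by move=> a u v; rewrite /coord linearP. Qed.

Lemma coordP x a u v : coord x (a *: u + v) = a * coord x u + coord x v.
Proof. exact: coord_is_linear. Qed.

Lemma coordZ x a u : coord x (a *: u) = a * coord x u.
Proof. by rewrite /coord linearZ. Qed.

Lemma coord_sum x (I : Type) (r : seq I) (f : I -> free_module) :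
  coord x (\sum_(i <- r) f i) = \sum_(i <- r) coord x (f i).
Proof. exact: (linear_sum (linear_of (coord_is_linear x))). Qed.

Lemma free_ext (u v : free_module) : (forall x, coord x u = coord x v) -> u = v.
Proof. by move=> uv; apply: val_inj; apply: funext. Qed.

Lemma free_support (u : free_module) :
  {s : seq X | forall x, x \notin s -> coord x u = 0}.
Proof. by apply: cid; have := valP u; rewrite inE => /asboolP. Qed.

Fact free_basis_subproof (x : X) :
  (fun y => (y == x)%:R : S^o) \in finitely_supported.
Proof.
by rewrite inE; apply/asboolP; exists [:: x] => y; rewrite inE => /negbTE ->.
Qed.
Definition free_basis x : free_module := FreeModule (free_basis_subproof x).

Lemma coord_basis x y : coord y (free_basis x) = (y == x)%:R.
Proof. by []. Qed.

Definition free_lift (V : lmodType S) (f : X -> V) (u : free_module) : V :=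
  \sum_(x <- undup (sval (free_support u))) coord x u *: f x.

Lemma free_liftE (V : lmodType S) (f : X -> V) u (s : seq X) :
  uniq s -> (forall x, x \notin s -> coord x u = 0) ->
  free_lift f u = \sum_(x <- s) coord x u *: f x.
Proof.
have widen (r t : seq X) : uniq r -> (forall x, x \notin t -> coord x u = 0) ->
  \sum_(x <- r) coord x u *: f x = \sum_(x <- r | x \in t) coord x u *: f x.
  move=> rU ut; rewrite (bigID (mem t)) /= [X in _ + X]big1 ?addr0 // => x xt.
  by rewrite ut // scale0r.
rewrite /free_lift; case: (free_support u) => t /= ut sU us.
have ut' x : x \notin undup t -> coord x u = 0 by rewrite mem_undup; apply: ut.
rewrite (widen _ s (undup_uniq t) us) (widen s _ sU ut').
rewrite -[LHS]big_filter -[RHS]big_filter; apply: perm_big; apply: uniq_perm.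
- by rewrite filter_uniq ?undup_uniq.
- by rewrite filter_uniq.
by move=> x; rewrite !mem_filter andbC.
Qed.

Lemma free_lift_linear (V : lmodType S) (f : X -> V) : linear (free_lift f).
Proof.
move=> a u v.
have [[s us] [t vt]] := (free_support u, free_support v).
have [nu nv] : (forall x, x \notin undup (s ++ t) -> coord x u = 0) /\
    (forall x, x \notin undup (s ++ t) -> coord x v = 0).
  by split=> x; rewrite mem_undup mem_cat negb_or => /andP[? ?]; auto.
rewrite !(@free_liftE _ f _ (undup (s ++ t))) ?undup_uniq //; last first.
  by move=> x xs; rewrite coordP nu // nv // mulr0 addr0.
rewrite scaler_sumr -big_split; apply: eq_bigr => x _ /=.
by rewrite coordP scalerDl scalerA.
Qed.

Lemma free_lift_basis (V : lmodType S) (f : X -> V) x :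
  free_lift f (free_basis x) = f x.
Proof.
rewrite (@free_liftE _ f _ [:: x]) // ?big_seq1 ?coord_basis ?eqxx ?scale1r //.
by move=> y; rewrite inE coord_basis => /negbTE ->.
Qed.

Lemma free_lift_id u (s : seq X) :
  uniq s -> (forall x, x \notin s -> coord x u = 0) ->
  u = \sum_(x <- s) coord x u *: free_basis x.
Proof.
move=> sU us; apply: free_ext => y; rewrite coord_sum.
have [ys|ys] := boolP (y \in s); last first.
  rewrite us // big_seq big1 // => x xs; rewrite coordZ coord_basis.
  by case: eqP ys => [->|_ _]; rewrite ?xs ?mulr0.
rewrite (bigD1_seq y) //= coordZ coord_basis eqxx mulr1 big1 ?addr0 //.
by move=> x /negbTE xy; rewrite coordZ coord_basis eq_sym xy mulr0.
Qed.

Lemma free_lift_map (U V : lmodType S) (f : X -> U) (g : {linear U -> V}) u :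
  g (free_lift f u) = free_lift (fun x => g (f x)) u.
Proof.
by rewrite /free_lift linear_sum; apply: eq_bigr => x _; rewrite linearZ.
Qed.

Lemma free_lift_ext (V : lmodType S) (f : {linear free_module -> V}) u :
  f u = free_lift (fun x => f (free_basis x)) u.
Proof.
rewrite -free_lift_map; congr (f _); rewrite /free_lift.
case: (free_support u) => s /= us; apply: free_lift_id; first exact: undup_uniq.
by move=> x; rewrite mem_undup; apply: us.
Qed.

Lemma free_projective : is_projective free_module.
Proof.
move=> U V g f gS.
have /choice[h hE] : forall x, exists u, g u = f (free_basis x) by [].
exists (linear_of (free_lift_linear h)) => u.
rewrite [RHS]free_lift_ext [LHS]free_lift_map.
by apply: eq_bigr => x _; rewrite hE.
Qed.

End FreeModule.

Section Covers.
Variable S : pzRingType.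

(** The expansion is required over every duplicate-free list containing a given
    one, rather than over one list: two elements then share a list, which makes
    the condition additive. *)
Definition has_dual_basis (P : lmodType S) : Prop :=
  exists (X : eqType) (e : X -> P) (c : X -> {linear P -> S^o}), forall u,
  exists s : seq X, forall t, uniq t -> {subset s <= t} ->
    u = \sum_(x <- t) (c x u : S) *: e x.

Lemma free_dual_basis (X : eqType) : has_dual_basis (free_module S X).
Proof.
exists X, (@free_basis S X), (fun x => linear_of (@coord_is_linear S X x)) => u.
have [s us] := free_support u; exists s => t tU st.
by apply: free_lift_id => // x xt; apply: us; apply: contra xt; apply: st.
Qed.

(** Covering a whole family by one module makes the disk complex constant in the
    degree, hence free of transport between indices.  The free module on the
    disjoint union of the family does it: each member is hit by its own summand. *)
Lemma common_free_cover (I : eqType) (F : I -> lmodType S) :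
  exists P : lmodType S, [/\ is_projective P, has_dual_basis P
    & forall i, exists g : {linear P -> F i}, surjective g].
Proof.
pose X : eqType := {i : I & F i}.
exists (free_module S X); split; first exact: free_projective.
  exact: free_dual_basis.
move=> i.
pose f (x : X) : F i :=
  if tag x =P i is ReflectT ix then ecast j (F j) ix (tagged x) else 0.
exists (linear_of (free_lift_linear f)) => v.
exists (free_basis S (Tagged F v)); rewrite /= free_lift_basis /f /=.
by case: eqP => // ii; rewrite (eq_axiomK ii).
Qed.

Lemma free_cover (M : lmodType S) :
  exists (P : lmodType S) (g : {linear P -> M}),
    [/\ is_projective P, has_dual_basis P & surjective g].
Proof.
have [P [pP dP /(_ tt)[g gS]]] := @common_free_cover unit (fun=> M).
by exists P, g.
Qed.

(** A dual basis of a free cover restricts along a splitting of the cover. *)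
Lemma projective_dual_basis (P : lmodType S) :
  is_projective P -> has_dual_basis P.
Proof.
move=> pP; have [L [g [_ [X [e [c ce]]] gS]]] := free_cover P.
have [h hK] := pP _ _ g idfun gS.
have cL x : linear (fun u => c x (h u) : S^o) by move=> a u v; rewrite !linearP.
exists X, (fun x => g (e x)), (fun x => linear_of (cL x)) => u.
have [s sE] := ce (h u); exists s => t tU st.
rewrite -[LHS]hK [in LHS](sE t tU st) linear_sum.
by apply: eq_bigr => x _; rewrite linearZ.
Qed.

(** Maps out of a product are sums of maps out of the factors, so they lift
    factor by factor. *)
Lemma projective_prod (P Q : lmodType S) :
  is_projective P -> is_projective Q -> is_projective (P * Q)%type.
Proof.
move=> pP pQ U V g f gS.
pose fP : {linear P -> V} := f \o linear_inl P Q.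
pose fQ : {linear Q -> V} := f \o linear_inr P Q.
have [[h hE] [k kE]] := (pP _ _ g fP gS, pQ _ _ g fQ gS).
have hkL : linear (fun x : P * Q => h x.1 + k x.2).
  by move=> a x y; rewrite /= !linearP scalerDr addrACA.
exists (linear_of hkL) => -[x y] /=; rewrite linearD hE kE /= -linearD.
by congr (f (_, _)); rewrite /= ?addr0 ?add0r.
Qed.

Lemma projective_retract (P Q : lmodType S) (i : {linear Q -> P})
    (r : {linear P -> Q}) :
  (forall x, r (i x) = x) -> is_projective P -> is_projective Q.
Proof.
move=> ri pP U V g f gS.
have [h hE] := pP _ _ g (f \o r : {linear P -> V}) gS.
by exists (h \o i : {linear Q -> U}) => x; rewrite /= hE /= ri.
Qed.

End Covers.

(** * Tensor products *)

Section TensorAlgebra.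
Variables (R : pzRingType) (N : lmodType R^c) (M : lmodType R).
Implicit Types (x : N) (y : M) (t u : tensor N M).

Lemma tens_zmodl y : zmod_morphism (fun x => tens x y : tensor N M).
Proof.
by move=> x x'; apply: (addIr (tens x' y)); rewrite subrK -tensDl subrK.
Qed.

Lemma tens_zmodr x : zmod_morphism (fun y => tens x y : tensor N M).
Proof.
by move=> y y'; apply: (addIr (tens x y')); rewrite subrK -tensDr subrK.
Qed.

Lemma tensBl x x' y : tens (x - x') y = tens x y - tens x' y :> tensor N M.
Proof. exact: tens_zmodl. Qed.

Lemma tensBr x y y' : tens x (y - y') = tens x y - tens x y' :> tensor N M.
Proof. exact: tens_zmodr. Qed.

Lemma tens0l y : tens 0 y = 0 :> tensor N M.
Proof. by rewrite -[X in tens X _](subrr 0) tensBl subrr. Qed.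

Lemma tens0r x : tens x 0 = 0 :> tensor N M.
Proof. by rewrite -[X in tens _ X](subrr 0) tensBr subrr. Qed.

Lemma tensMzl x y (n : int) : tens x y *~ n = tens (x *~ n) y :> tensor N M.
Proof.
pose T : {additive N -> tensor N M} :=
  HB.pack (fun x => tens x y : tensor N M)
    (GRing.isZmodMorphism.Build _ _ _ (tens_zmodl y)).
by rewrite -[RHS]/(T (x *~ n)) raddfMz.
Qed.

Lemma tens_sumr x (I : Type) (r : seq I) (f : I -> M) :
  tens x (\sum_(i <- r) f i) = \sum_(i <- r) tens x (f i) :> tensor N M.
Proof.
elim: r => [|i r IHr]; first by rewrite !big_nil tens0r.
by rewrite !big_cons tensDr IHr.
Qed.

Lemma tens_suml (I : Type) (r : seq I) (f : I -> N) y :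
  tens (\sum_(i <- r) f i) y = \sum_(i <- r) tens (f i) y :> tensor N M.
Proof.
elim: r => [|i r IHr]; first by rewrite !big_nil tens0l.
by rewrite !big_cons tensDl IHr.
Qed.

Lemma tensor_ind (P : tensor N M -> Prop) :
  (forall x y, P (tens x y)) -> (forall t u, P t -> P u -> P (t + u)) ->
  forall t, P t.
Proof.
move=> Ptens PD t; rewrite -[t]tensor_piK -(freeg_sumE (repr t)) raddf_sum.
elim/big_ind: _ => [|//|[x y] _]; first by rewrite -(tens0l 0).
by rewrite -[coeff _ _]intz -freegU_mulz raddfMz [X in X *~ _]/(tens x y) tensMzl.
Qed.

End TensorAlgebra.

Section TensorMaps.
Variable R : pzRingType.

Lemma tensor_mapD (N N' : lmodType R^c) (M M' : lmodType R)
    (f : {linear N -> N'}) (g : {linear M -> M'}) t u :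
  tensor_map f g (t + u) = tensor_map f g t + tensor_map f g u.
Proof. exact: raddfD. Qed.

Lemma tensor_map_square (N N1 N2 N' : lmodType R^c) (M M1 M2 M' : lmodType R)
    (f1 : {linear N -> N1}) (g1 : {linear M -> M1})
    (f1' : {linear N1 -> N'}) (g1' : {linear M1 -> M'})
    (f2 : {linear N -> N2}) (g2 : {linear M -> M2})
    (f2' : {linear N2 -> N'}) (g2' : {linear M2 -> M'}) t :
  (forall x, f1' (f1 x) = f2' (f2 x)) -> (forall y, g1' (g1 y) = g2' (g2 y)) ->
  tensor_map f1' g1' (tensor_map f1 g1 t)
    = tensor_map f2' g2' (tensor_map f2 g2 t).
Proof.
move=> fE gE; elim/tensor_ind: t => [x y|t u tE uE].
  by rewrite !tensor_map_tens fE gE.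
by rewrite !tensor_mapD tE uE.
Qed.

Lemma tensor_map_comp0 (N N1 N2 : lmodType R^c) (M M1 M2 : lmodType R)
    (f : {linear N -> N1}) (g : {linear M -> M1})
    (f' : {linear N1 -> N2}) (g' : {linear M1 -> M2}) t :
  (forall x, f' (f x) = 0) \/ (forall y, g' (g y) = 0) ->
  tensor_map f' g' (tensor_map f g t) = 0.
Proof.
move=> fg0; elim/tensor_ind: t => [x y|t u tE uE].
  rewrite !tensor_map_tens.
  by case: fg0 => ->; rewrite ?tens0l ?tens0r.
by rewrite !tensor_mapD tE uE addr0.
Qed.

Lemma tensor_map_surjective (N N' : lmodType R^c) (M M' : lmodType R)
    (f : {linear N -> N'}) (g : {linear M -> M'}) :
  surjective f -> surjective g -> surjective (tensor_map f g).
Proof.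
move=> fS gS; elim/tensor_ind => [x' y'|_ _ [t <-] [u <-]]; last first.
  by exists (t + u); rewrite tensor_mapD.
have [[x <-] [y <-]] := (fS x', gS y').
by exists (tens x y); rewrite tensor_map_tens.
Qed.

End TensorMaps.

Section Cokernel.
Variables (A B : zmodType) (f : {additive A -> B}).

Definition additive_image : {pred B} := [pred b | `[< exists a, f a = b >]].

Fact additive_image_zmod_closed : zmod_closed additive_image.
Proof.
split=> [|b c]; rewrite !inE; first by apply/asboolP; exists 0; rewrite raddf0.
move=> /asboolP[x <-] /asboolP[y <-]; apply/asboolP.
by exists (x - y); rewrite raddfB.
Qed.

HB.instance Definition _ :=
  GRing.isZmodClosed.Build B additive_image additive_image_zmod_closed.

Lemma cokernel : exists (C : zmodType) (q : {additive B -> C}), is_exact f q.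
Proof.
pose C : zmodType := Quotient.quot additive_image.
pose pr b : C := \pi_(Quotient.quot additive_image)%qT b.
have prB : zmod_morphism pr by exact: raddfB.
pose q : {additive B -> C} := HB.pack pr (GRing.isZmodMorphism.Build _ _ pr prB).
have q0 b : (q b == 0) = (b \in additive_image).
  by rewrite -[0](raddf0 q) -Quotient.idealrBE subr0.
exists C, q => b; split=> [/eqP|[a <-]]; first by rewrite q0 inE => /asboolP.
by apply/eqP; rewrite q0 inE; apply/asboolP; exists a.
Qed.

End Cokernel.

Section TensorExactness.
Variable R : pzRingType.

(** Right exactness in both variables at once: choosing preimages under [p] and
    [q] turns [h] into a balanced map on the quotients. *)
Lemma tensor_map_kernel (N N' : lmodType R^c) (M M' : lmodType R)
    (p : {linear N -> N'}) (q : {linear M -> M'}) (A : zmodType)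
    (h : {additive tensor N M -> A}) t :
  surjective p -> surjective q ->
  (forall x y, p x = 0 -> h (tens x y) = 0) ->
  (forall x y, q y = 0 -> h (tens x y) = 0) ->
  tensor_map p q t = 0 -> h t = 0.
Proof.
move=> /choice[s sK] /choice[r rK] hp hq t0.
have hE x1 x2 y1 y2 : p x1 = p x2 -> q y1 = q y2 ->
    h (tens x1 y1) = h (tens x2 y2).
  move=> px qy; transitivity (h (tens x1 y2)); apply/eqP.
    by rewrite -subr_eq0 -raddfB -tensBr hq // linearB qy subrr.
  by rewrite -subr_eq0 -raddfB -tensBl hp // linearB px subrr.
pose b x y := h (tens (s x) (r y)).
have [||a x y|k [kE _]] := @tensor_lift R N' M' A b.
- move=> x x' y; rewrite /b -raddfD -tensDl; apply: hE => //.
  by rewrite linearD !sK.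
- move=> x y y'; rewrite /b -raddfD -tensDr; apply: hE => //.
  by rewrite linearD !rK.
- transitivity (h (tens ((a : R^c) *: s x) (r y))).
    by apply: hE => //; rewrite linearZ !sK.
  by rewrite tensZ; apply: hE => //; rewrite linearZ !rK.
suff <- : k (tensor_map p q t) = h t by rewrite t0 raddf0.
elim/tensor_ind: t {t0} => [x y|t u tE uE].
  by rewrite tensor_map_tens kE; apply: hE; rewrite ?sK ?rK.
by rewrite tensor_mapD !raddfD tE uE.
Qed.

Lemma tensor_right_exactr (N : lmodType R^c) (A B C : lmodType R)
    (f : {linear A -> B}) (g : {linear B -> C}) :
  is_exact f g -> surjective g ->
  is_exact (tensor_map (@idfun N) f) (tensor_map (@idfun N) g).
Proof.
move=> fg gS t; split=> [t0|[u <-]]; last first.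
  by apply: tensor_map_comp0; right=> y; apply/fg; exists y.
have [Q [h hE]] := cokernel (tensor_map (@idfun N) f).
apply/hE; apply: (@tensor_map_kernel _ _ _ _ idfun g Q h) t0 => //.
- by move=> x; exists x.
- by move=> x y /= ->; rewrite tens0l raddf0.
by move=> x y /fg[z <-]; apply/hE; exists (tens x z); exact: tensor_map_tens.
Qed.

Lemma tensor_right_exactl (M : lmodType R) (A B C : lmodType R^c)
    (f : {linear A -> B}) (g : {linear B -> C}) :
  is_exact f g -> surjective g ->
  is_exact (tensor_map f (@idfun M)) (tensor_map g (@idfun M)).
Proof.
move=> fg gS t; split=> [t0|[u <-]]; last first.
  by apply: tensor_map_comp0; left=> y; apply/fg; exists y.
have [Q [h hE]] := cokernel (tensor_map f (@idfun M)).
apply/hE; apply: (@tensor_map_kernel _ _ _ _ g idfun Q h) t0 => //.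
- by move=> x; exists x.
- by move=> x y /fg[z <-]; apply/hE; exists (tens z y); exact: tensor_map_tens.
by move=> x y /= ->; rewrite tens0r raddf0.
Qed.

(** A dual basis of [P] gives the elements of [tensor N P] coordinates in [N] that
    are natural in [N] and determine them, so exactness can be checked one
    coordinate at a time. *)
Lemma projective_flat (P : lmodType R) : is_projective P -> is_flat P.
Proof.
move=> /projective_dual_basis[X [e [c ce]]].
pose b (N : lmodType R^c) (x : X) (n : N) (u : P) : N := (c x u : R^c) *: n.
have coordP (N : lmodType R^c) : exists k : X -> {additive tensor N P -> N},
    forall x n u, k x (tens n u) = b N x n u.
  suff /choice[k kE] : forall x, exists k : {additive tensor N P -> N},
      forall n u, k (tens n u) = b N x n u by exists k.
  move=> x.
  have [||r n u|k [kE _]] := @tensor_lift R N P N (b N x).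
  - by move=> n n' u; rewrite /b scalerDr.
  - by move=> n u u'; rewrite /b linearD -scalerDl.
  - by rewrite /b scalerA linearZ.
  by exists k.
have expand (N : lmodType R^c) (k : X -> {additive tensor N P -> N}) t :
    (forall x n u, k x (tens n u) = b N x n u) ->
  exists s : seq X, forall s', uniq s' -> {subset s <= s'} ->
    t = \sum_(x <- s') tens (k x t) (e x).
  move=> kE; elim/tensor_ind: t => [n u|t u [s tE] [s2 uE]].
    have [s sE] := ce u; exists s => s' sU ss'.
    rewrite [in LHS](sE s' sU ss') tens_sumr; apply: eq_bigr => x _.
    by rewrite -tensZ kE.
  exists (s ++ s2) => s' sU ss'.
  have [st su] : {subset s <= s'} /\ {subset s2 <= s'}.
    by split=> x xs; apply: ss'; rewrite mem_cat xs ?orbT.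
  rewrite [in LHS](tE s' sU st) [in LHS](uE s' sU su) -big_split.
  by apply: eq_bigr => x _; rewrite raddfD tensDl.
move=> A B C f g fg t; split=> [t0|[u <-]]; last first.
  by apply: tensor_map_comp0; left=> y; apply/fg; exists y.
have [[kB kBE] [kC kCE]] := (coordP B, coordP C).
have kN x v : kC x (tensor_map g idfun v) = g (kB x v).
  elim/tensor_ind: v => [n w|v w vE wE].
    by rewrite tensor_map_tens kBE kCE /b linearZ.
  by rewrite tensor_mapD !raddfD vE wE.
(* Only the coordinates of [t] in the finite list [s] enter the preimage. *)
have /choice[a aE] : forall x, exists a, f a = kB x t.
  by move=> x; apply/fg; rewrite -kN t0 raddf0.
have [s sE] := expand B kB t kBE.
exists (\sum_(x <- undup s) tens (a x) (e x)).
rewrite raddf_sum [RHS](sE (undup s)) ?undup_uniq //; last first.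
  by move=> x; rewrite mem_undup.
by apply: eq_bigr => x _; rewrite [LHS]tensor_map_tens aE.
Qed.

(** The same coordinates for the right module: [f] acts on each of them
    separately, and they determine the tensor. *)
Lemma dual_basis_tensor_injective (L : lmodType R^c) (A B : lmodType R)
    (f : {linear A -> B}) :
  has_dual_basis L -> injective f -> injective (tensor_map (@idfun L) f).
Proof.
move=> [X [e [c ce]]] fI.
pose b (M : lmodType R) (x : X) (u : L) (m : M) : M := (c x u : R) *: m.
have coordP (M : lmodType R) : exists k : X -> {additive tensor L M -> M},
    forall x u m, k x (tens u m) = b M x u m.
  suff /choice[k kE] : forall x, exists k : {additive tensor L M -> M},
      forall u m, k (tens u m) = b M x u m by exists k.
  move=> x.
  have [||r u m|k [kE _]] := @tensor_lift R L M M (b M x).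
  - by move=> u u' m; rewrite /b linearD -scalerDl.
  - by move=> u m m'; rewrite /b scalerDr.
  - by rewrite /b scalerA linearZ.
  by exists k.
have [[kA kAE] [kB kBE]] := (coordP A, coordP B).
have kN x v : kB x (tensor_map idfun f v) = f (kA x v).
  elim/tensor_ind: v => [n w|v w vE wE].
    by rewrite tensor_map_tens kAE kBE /b linearZ.
  by rewrite tensor_mapD !raddfD vE wE.
have expand t : exists s : seq X, forall s', uniq s' -> {subset s <= s'} ->
    t = \sum_(x <- s') tens (e x) (kA x t).
  elim/tensor_ind: t => [u m|t u [s tE] [s2 uE]].
    have [s sE] := ce u; exists s => s' sU ss'.
    rewrite [in LHS](sE s' sU ss') tens_suml; apply: eq_bigr => x _.
    by rewrite tensZ kAE.
  exists (s ++ s2) => s' sU ss'.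
  have [st su] : {subset s <= s'} /\ {subset s2 <= s'}.
    by split=> x xs; apply: ss'; rewrite mem_cat xs ?orbT.
  rewrite [in LHS](tE s' sU st) [in LHS](uE s' sU su) -big_split.
  by apply: eq_bigr => x _; rewrite raddfD tensDr.
apply: raddf_inj => t t0; have [s /(_ (undup s) (undup_uniq s))->] := expand t.
  rewrite big1 // => x _; have -> : kA x t = 0; last by rewrite tens0r.
  by apply: fI; rewrite -kN t0 !raddf0.
by move=> x; rewrite mem_undup.
Qed.

Lemma flat_tensor_injective (F : lmodType R) (A B : lmodType R^c)
    (f : {linear A -> B}) :
  is_flat F -> injective f -> injective (tensor_map f (@idfun F)).
Proof.
(* Injectivity of [f] is its exactness with the zero map into [A]. *)
move=> fF fI; pose z : {linear A -> A} := \0.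
have zf : is_exact z f.
  move=> x; split=> [fx|[y <-]]; last exact: raddf0.
  by exists 0; apply: fI; rewrite fx !raddf0.
apply: raddf_inj => t /(fF _ _ _ _ _ zf)[u <-].
elim/tensor_ind: u => [x y|u v uE vE].
  by rewrite tensor_map_tens tens0l.
by rewrite tensor_mapD uE vE addr0.
Qed.

(** This is the vanishing of Tor_1(N, F), by a snake chase in the tensor product
    of 0 -> K -> Q -> F -> 0 with a presentation 0 -> N' -> L -> N -> 0, L free:
    a kernel element of N (x) K lifts to L (x) K, lands in the image of N' (x) Q
    inside L (x) Q, and flatness of [F] pulls it back to N' (x) K. *)
Lemma flat_quotient_tensor_injective (K Q F : lmodType R)
    (j : {linear K -> Q}) (s : {linear Q -> F}) (N : lmodType R^c) :
  short_exact j s -> is_flat F -> injective (tensor_map (@idfun N) j).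
Proof.
move=> [jI js sS] fF; apply: raddf_inj => t t0.
have [L [p [_ dL pS]]] := free_cover N.
pose i := ker_incl p; have ip : is_exact i p := @ker_incl_exact _ _ _ p.
have idS T : surjective (@idfun T) by move=> x; exists x.
have [u uE] := @tensor_map_surjective _ _ _ _ _ p idfun pS (idS K) t.
have /(tensor_right_exactl ip pS)[v vE] :
    tensor_map p (@idfun Q) (tensor_map (@idfun L) j u) = 0.
  rewrite (@tensor_map_square _ _ _ N _ _ _ K _ _ _ _ _ p idfun idfun j) //.
  by rewrite uE.
have iI : injective i by exact: ker_incl_inj.
have vF : tensor_map (@idfun (ker_type p)) s v = 0.
  apply: (flat_tensor_injective fF iI); rewrite raddf0.
  rewrite (@tensor_map_square _ _ _ L _ _ _ Q _ _ _ _ _ i idfun idfun s) //.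
  by rewrite vE tensor_map_comp0 //; right=> y; apply/js; exists y.
have [w wE] := (tensor_right_exactr (N := ker_type p) js sS v).1 vF.
have uw : u = tensor_map i (@idfun K) w.
  apply: (dual_basis_tensor_injective dL jI); rewrite -vE -wE.
  exact: tensor_map_square.
rewrite -uE uw tensor_map_comp0 //; left=> x; exact: ker_inclK.
Qed.

(** Tensoring [ker f -> A -> B -> C] with the columns [K], [Q] and [F] turns
    exactness of the [K]-column at [B] into an instance of the diagram chase; the
    term [ker f] is there to make the [F]-column exact at [A]. *)
Lemma flat_kernel (K Q F : lmodType R) (j : {linear K -> Q})
    (s : {linear Q -> F}) :
  short_exact j s -> is_flat Q -> is_flat F -> is_flat K.
Proof.
move=> ses fQ fF A B C f g fg; have [jI js sS] := ses.
have idS T : surjective (@idfun T) by move=> x; exists x.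
apply: (@exact_kernel_complex _ _ _ _ _ _ _ _ _ _ _ _
  (tensor_map (ker_incl f) (@idfun Q)) (tensor_map f (@idfun Q))
  (tensor_map g (@idfun Q))
  (tensor_map (ker_incl f) (@idfun F)) (tensor_map f (@idfun F))
  (tensor_map (@idfun A) j) (tensor_map (@idfun B) j) (tensor_map (@idfun C) j)
  (tensor_map (@idfun (ker_type f)) s) (tensor_map (@idfun A) s)
  (tensor_map (@idfun B) s)).
- exact: fQ.
- by apply: fF; exact: ker_incl_exact.
- by move=> x; apply: tensor_map_comp0; left=> y; exact: ker_inclK.
- by move=> x; exact: tensor_map_square.
- by move=> x; exact: tensor_map_square.
- by move=> x; exact: tensor_map_square.
- by move=> x; exact: tensor_map_square.
- exact: flat_quotient_tensor_injective ses fF.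
- exact: flat_quotient_tensor_injective ses fF.
- exact: tensor_right_exactr.
- by move=> x; apply: tensor_map_comp0; right=> y; apply/js; exists y.
- exact: tensor_map_surjective.
Qed.

End TensorExactness.

(** * Projective dimension *)

Section ProjectiveDimension.
Variable R : pzRingType.

(** Every first syzygy is required to satisfy the bound, so that it can be applied
    to the kernel of a given cover; [pd_le_syzygy] shows that one syzygy is
    enough. *)
Fixpoint pd_le (n : nat) (M : lmodType R) : Prop :=
  if n is m.+1 then
    forall (K Q : lmodType R) (j : {linear K -> Q}) (s : {linear Q -> M}),
      is_projective Q -> short_exact j s -> pd_le m K
  else is_projective M.

(** Schanuel's lemma for a retract: the lift [b \o a : Q -> Q] of the identity
    of [A] differs from the identity by a map into [K], so the identity of [K]
    factors through [K' * Q]. *)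
Lemma schanuel_retract (K Q A K' Q' M : lmodType R)
    (j : {linear K -> Q}) (s : {linear Q -> A})
    (j' : {linear K' -> Q'}) (s' : {linear Q' -> M})
    (i : {linear A -> M}) (r : {linear M -> A}) :
  is_projective Q -> is_projective Q' -> short_exact j s -> short_exact j' s' ->
  (forall x, r (i x) = x) ->
  exists (u : {linear K -> (K' * Q)%type}) (v : {linear (K' * Q)%type -> K}),
    forall x, v (u x) = x.
Proof.
move=> pQ pQ' [jI js sS] [j'I js' s'S] ri.
have [a aE] := pQ _ _ s' (i \o s : {linear Q -> M}) s'S.
have [b bE] := pQ' _ _ s (r \o s' : {linear Q' -> A}) sS.
have [x|a' a'E] := lift_along_kernel (h := a \o j : {linear K -> Q'}) j'I js'.
  by rewrite /= aE /= (js (j x)).2 ?raddf0 //; exists x.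
have [x|b' b'E] := lift_along_kernel (h := b \o j' : {linear K' -> Q}) jI js.
  by rewrite /= bE /= (js' (j' x)).2 ?raddf0 //; exists x.
pose c : {linear Q -> Q} := (b \o a) \- idfun.
have [x|c' c'E] := lift_along_kernel (h := c) jI js.
  by rewrite /c /= linearB bE /= aE /= ri subrr.
have uL : linear (fun x => (a' x, j x)) by move=> k x y; rewrite !linearP.
have vL : linear (fun y : K' * Q => b' y.1 - c' y.2).
  by move=> k x y; rewrite /= !linearP scalerDr addrACA.
exists (linear_of uL), (linear_of vL) => x; apply: jI => /=.
by rewrite linearB b'E c'E /c /= a'E /= opprB addrC subrK.
Qed.

(** The part of a cover of [K * Q] lying over [K] is projective because the
    cover splits over [Q], and it has the same kernel. *)
Lemma pd_le_prod_projective n (K Q : lmodType R) :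
  pd_le n K -> is_projective Q -> pd_le n (K * Q)%type.
Proof.
case: n => [|n] pK pQ; first exact: projective_prod.
move=> L T j s pT [jI js sS].
pose q : {linear T -> Q} := linear_snd K Q \o s.
have [|c cE] := pQ _ _ q idfun.
  by move=> y; have [t tE] := sS (0, y); exists t; rewrite /= tE.
pose d : {linear T -> T} := idfun \- (c \o q).
have qd t : q (d t) = 0.
  transitivity (q (t - c (q t))) => //.
  by rewrite linearB [q (c _)]cE subrr.
have pT' : is_projective (ker_type q).
  apply: (@projective_retract _ T _ (ker_incl q) (corestrict qd)) pT => x.
  apply: ker_incl_inj; rewrite ker_incl_corestrict /d /=.
  by rewrite [X in c X](ker_inclK x) raddf0 subr0.
have qj x : q (j x) = 0 by rewrite /= (js (j x)).2 //; exists x.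
pose s' : {linear ker_type q -> K} := linear_fst K Q \o (s \o ker_incl q).
apply: (pK L (ker_type q) (corestrict qj) s' pT'); split.
- by move=> x y /(congr1 (ker_incl q)) /= /jI.
- move=> t; split=> [t0|[x <-]]; last by rewrite /= (js (j x)).2 //; exists x.
  have /js[x xE] : s (ker_incl q t) = 0.
    by rewrite [LHS]surjective_pairing [X in (_, X)](ker_inclK t) [X in (X, _)]t0.
  by exists x; apply: ker_incl_inj.
- move=> x; have [t tE] := sS (x, 0).
  have /ker_incl_exact[t' t'E] : q t = 0 by rewrite /= tE.
  by exists t'; rewrite /= [ker_val _]t'E tE.
Qed.

(** By [schanuel_retract] a syzygy of a retract of [M] is a retract of a syzygy of
    [M] plus a projective, so the induction runs over all retracts at once. *)
Lemma pd_le_retract n (A M : lmodType R) (i : {linear A -> M})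
    (r : {linear M -> A}) :
  (forall x, r (i x) = x) -> pd_le n M -> pd_le n A.
Proof.
elim: n A M i r => [|n IHn] A M i r ri pM; first exact: projective_retract ri pM.
move=> K Q j s pQ js; have [Q' [s' [pQ' _ s'S]]] := free_cover M.
have js' := ker_short_exact s'S.
have [u [v uv]] := schanuel_retract pQ pQ' js js' ri.
apply: IHn uv _; apply: pd_le_prod_projective => //.
exact: pM pQ' js'.
Qed.

Lemma pd_le_syzygy n (K Q M : lmodType R) (j : {linear K -> Q})
    (s : {linear Q -> M}) :
  is_projective Q -> short_exact j s -> pd_le n K -> pd_le n.+1 M.
Proof.
move=> pQ js pK K' Q' j' s' pQ' js'.
have [u [v uv]] :=
  @schanuel_retract _ _ _ _ _ _ _ _ _ _ idfun idfun pQ' pQ js' js (fun=> erefl).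
by apply: pd_le_retract uv _; exact: pd_le_prod_projective.
Qed.

Lemma resolution_pd_le n (M : lmodType R) (X : nat -> lmodType R)
    (d : forall k, {linear X k.+1 -> X k}) (e : {linear X 0%N -> M}) :
  resolution n d e -> (forall k, is_projective (X k)) -> pd_le n M.
Proof.
elim: n M X d e => [|n IHn] M X d e [eS de dd X0] pX.
  (* For n = 0 the augmentation [e] is bijective since [X 1] vanishes. *)
  have eI : injective e.
    apply: raddf_inj => x /de[y <-].
    by rewrite (X0 1%N isT y) raddf0.
  have /choice[k kE] := eS.
  have kL : linear k by move=> a x y; apply: eI; rewrite linearP !kE.
  exact: (@projective_retract _ (X 0%N) _ (linear_of kL) e).
have ed x : e (d 0%N x) = 0 by apply/de; exists x.
apply: pd_le_syzygy (pX 0%N) (ker_short_exact eS) _.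
apply: (IHn _ (fun k => X k.+1) (fun k => d k.+1) (corestrict ed)) => //.
split=> //.
- move=> y; have /de[x xE] := ker_inclK y.
  by exists x; apply: ker_incl_inj.
- move=> y; split=> [/(congr1 (ker_incl e))|[x <-]].
    by rewrite raddf0 => /dd.
  by apply: ker_incl_inj; rewrite raddf0; apply/dd; exists x.
- by move=> k kn; apply: X0.
Qed.

Lemma dim_le_leastP (P : nat -> Prop) p :
  dim_le (least P) p <-> exists2 n, (n <= p)%N & P n.
Proof.
rewrite /least; case: pselect => [h|h] /=; last first.
  by split=> // -[n _ Pn]; apply: h; exists n; apply/asboolP.
case: ex_minnP => m /asboolP Pm m_min; split=> [mp|[n np Pn]]; first by exists m.
by apply: leq_trans np; apply: m_min; apply/asboolP.
Qed.

Lemma dim_le_pd_le (M : lmodType R) p : dim_le (pd M) p -> pd_le p M.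
Proof.
move=> /dim_le_leastP[n np [X [d [e [[eS de dd X0] pX]]]]].
apply: (@resolution_pd_le p M X d e).
  by split=> // k pk; apply: X0; apply: leq_ltn_trans pk.
(* Above the length the terms vanish, and zero modules are projective. *)
move=> k; have [/pX//|nk] := leqP k n.
move=> U V g f gS; exists \0 => x.
by rewrite (X0 k nk x) !raddf0.
Qed.

End ProjectiveDimension.

(** * Disk complexes and projective modules *)

Section Disk.
Variables (R : pzRingType) (P : lmodType R).

Fact disk_diff_is_linear : linear (fun x : P * P => (0, x.1) : P * P).
Proof. by move=> a x y; congr (_, _); rewrite /= scaler0 addr0. Qed.
Definition disk_diff : {linear (P * P)%type -> (P * P)%type} :=
  linear_of disk_diff_is_linear.

Fact disk_homotopy_is_linear : linear (fun x : P * P => (x.2, 0) : P * P).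
Proof. by move=> a x y; congr (_, _); rewrite /= scaler0 addr0. Qed.
Definition disk_homotopy : {linear (P * P)%type -> (P * P)%type} :=
  linear_of disk_homotopy_is_linear.

Lemma disk_diff_diff x : disk_diff (disk_diff x) = 0.
Proof. by []. Qed.

Lemma disk_exact : is_exact disk_diff disk_diff.
Proof.
case=> a b; split=> [[a0]|[x <-]]; last exact: disk_diff_diff.
by exists (b, 0); rewrite a0.
Qed.

(** The contracting homotopy survives tensoring because it is additive. *)
Lemma disk_tensor_exact (N : lmodType R^c) :
  is_exact (tensor_map (@idfun N) disk_diff) (tensor_map (@idfun N) disk_diff).
Proof.
move=> t; split=> [t0|[u <-]]; last first.
  by apply: tensor_map_comp0; right=> x; exact: disk_diff_diff.
have htE : tensor_map (@idfun N) disk_diff (tensor_map (@idfun N) disk_homotopy t)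
    + tensor_map (@idfun N) disk_homotopy (tensor_map (@idfun N) disk_diff t) = t.
  elim/tensor_ind: {t0} t => [n [a b]|t u tE uE].
    rewrite !tensor_map_tens -tensDr; congr tens.
    by congr (_, _); rewrite /= ?addr0 ?add0r.
  by rewrite !tensor_mapD addrACA tE uE.
exists (tensor_map (@idfun N) disk_homotopy t).
by rewrite -[RHS]htE t0 raddf0 addr0.
Qed.

(** The direct sum, over all degrees [i], of the complexes [id : P -> P]
    concentrated in degrees [i] and [i - 1]. *)
Definition disk_complex : complex R :=
  @Complex R (fun=> (P * P)%type) (fun _ _ _ => disk_diff)
    (fun _ _ _ _ _ => disk_diff_diff).

(** The cycles of the disk complex are the second coordinates. *)
Lemma projective_PGF : is_projective P -> is_PGF P.
Proof.
move=> pP; exists disk_complex; split.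
- by move=> i; exact: projective_prod.
- by move=> i j k ij jk; exact: disk_exact.
- by move=> I _ i j k ij jk; exact: disk_tensor_exact.
exists 0.
have dP x : diff disk_complex (esym (subrK 1 0) : 0 = (0 - 1) + 1)
  (linear_inr P P x) = 0 by [].
exists (corestrict dP); exists (fun c => (ker_incl _ c).2) => [//|c].
apply: ker_incl_inj; have [/= c0] := ker_inclK c.
by rewrite [RHS]surjective_pairing; congr (_, _).
Qed.

End Disk.

(** * One step of the resolution *)

Section Cover.
Variables (R : pzRingType) (F : complex R) (P : lmodType R).
Variables (g : forall i, {linear P -> F i}).

(** The component in degree [i] of the map of complexes that is [g k] on the top
    of the disk in degrees [k] and [k - 1], for every [k]. *)
Definition cover_map i : {linear (P * P)%type -> F i} :=
  (g i \o linear_fst P P) \+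
  ((diff F (erefl (i + 1)) \o g (i + 1)) \o linear_snd P P).

Lemma cover_map_diff i j (ij : i = j + 1) x :
  cover_map j (disk_diff P x) = diff F ij (cover_map i x).
Proof.
case: x => a b; rewrite /cover_map /= linearD diff_diff addr0 raddf0 add0r.
by subst i.
Qed.

Lemma cover_map_surjective i :
  (forall k, surjective (g k)) -> surjective (cover_map i).
Proof.
move=> gS v; have [a aE] := gS i v.
by exists (a, 0); rewrite /cover_map /= !raddf0 addr0.
Qed.

Fact cover_kernel_diff_subproof i j (ij : i = j + 1)
    (x : ker_type (cover_map i)) :
  cover_map j ((disk_diff P \o ker_incl (cover_map i)) x) = 0.
Proof. by rewrite [LHS](cover_map_diff ij) ker_inclK raddf0. Qed.

Definition cover_kernel_diff i j (ij : i = j + 1) :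
    {linear ker_type (cover_map i) -> ker_type (cover_map j)} :=
  corestrict (cover_kernel_diff_subproof ij).

Fact cover_kernel_diff_diff i j k (ij : i = j + 1) (jk : j = k + 1) x :
  cover_kernel_diff jk (cover_kernel_diff ij x) = 0.
Proof. exact: ker_incl_inj. Qed.

Definition cover_kernel : complex R :=
  @Complex R (fun i => ker_type (cover_map i)) cover_kernel_diff
    cover_kernel_diff_diff.

Hypothesis gS : forall i, surjective (g i).

Lemma cover_short_exact i : short_exact (ker_incl (cover_map i)) (cover_map i).
Proof. by apply: ker_short_exact; exact: cover_map_surjective. Qed.

Lemma cover_kernel_acyclic : acyclic F -> acyclic cover_kernel.
Proof.
move=> aF i j k ij jk.
apply: (@exact_kernel_complex _ _ _ _ _ _ _ _ _ _ _ _
  (disk_diff P) (disk_diff P) (disk_diff P)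
  (diff F (erefl (i + 1))) (diff F ij)
  (ker_incl (cover_map i)) (ker_incl (cover_map j)) (ker_incl (cover_map k))
  (cover_map (i + 1)) (cover_map i) (cover_map j)).
- exact: disk_exact.
- exact: aF.
- exact: disk_diff_diff.
- by [].
- by [].
- by move=> x; exact/esym/cover_map_diff.
- by move=> x; exact/esym/cover_map_diff.
- exact: ker_incl_inj.
- exact: ker_incl_inj.
- exact: ker_incl_exact.
- exact: ker_inclK.
- exact: cover_map_surjective.
Qed.

(** Flatness of the [F i] keeps the columns short exact after tensoring, so the
    chase for [cover_kernel_acyclic] applies again. *)
Lemma cover_kernel_tensor_acyclic (N : lmodType R^c) :
  (forall i, is_flat (F i)) -> tensor_acyclic N F ->
  tensor_acyclic N cover_kernel.
Proof.
move=> fF aF i j k ij jk.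
have ses := cover_short_exact.
apply: (@exact_kernel_complex _ _ _ _ _ _ _ _ _ _ _ _
  (tensor_map (@idfun N) (disk_diff P)) (tensor_map (@idfun N) (disk_diff P))
  (tensor_map (@idfun N) (disk_diff P))
  (tensor_map (@idfun N) (diff F (erefl (i + 1))))
  (tensor_map (@idfun N) (diff F ij))
  (tensor_map (@idfun N) (ker_incl (cover_map i)))
  (tensor_map (@idfun N) (ker_incl (cover_map j)))
  (tensor_map (@idfun N) (ker_incl (cover_map k)))
  (tensor_map (@idfun N) (cover_map (i + 1)))
  (tensor_map (@idfun N) (cover_map i))
  (tensor_map (@idfun N) (cover_map j))).
- exact: disk_tensor_exact.
- exact: aF.
- by move=> x; apply: tensor_map_comp0; right=> y; exact: disk_diff_diff.
- by move=> x; exact: tensor_map_square.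
- by move=> x; exact: tensor_map_square.
- by move=> x; apply: tensor_map_square => // y; exact/esym/cover_map_diff.
- by move=> x; apply: tensor_map_square => // y; exact/esym/cover_map_diff.
- exact: flat_quotient_tensor_injective (ses k) (fF k).
- exact: flat_quotient_tensor_injective (ses j) (fF j).
- have [_ ex sS] := ses i; exact: tensor_right_exactr.
- by move=> x; apply: tensor_map_comp0; right=> y; exact: ker_inclK.
- have [_ _ sS] := ses (i + 1); apply: tensor_map_surjective => // x.
  by exists x.
Qed.

Lemma cover_kernel_F_totally_acyclic :
  is_projective P -> F_totally_acyclic F -> F_totally_acyclic cover_kernel.
Proof.
move=> pP [fF aF tF]; split.
- move=> i; apply: flat_kernel (cover_short_exact i) _ (fF i).
  by apply: projective_flat; exact: projective_prod.
- exact: cover_kernel_acyclic.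
- by move=> I inI; apply: cover_kernel_tensor_acyclic fF (tF I inI).
Qed.

(** Since [cover_kernel] is acyclic, taking cycles keeps the sequence
    kernel, disks, [F] short exact, and the cycles of the disks are [P].  Concretely
    [b : P] is sent to the boundary of [g (i + 1) b], and the cycles are all
    boundaries because [F] is acyclic. *)
Lemma cover_cycles i : acyclic F ->
  exists (j : {linear cycles cover_kernel i -> P})
         (s : {linear P -> cycles F i}), short_exact j s.
Proof.
move=> aF; pose e := esym (subrK 1 i) : i = (i - 1) + 1.
pose c : {linear P -> F i} := diff F (erefl (i + 1)) \o g (i + 1).
have cE b : diff F e (c b) = 0 by exact: diff_diff.
pose s := corestrict cE.
pose j : {linear cycles cover_kernel i -> P} :=
  linear_snd P P \o (ker_incl (cover_map i) \o ker_incl (diff cover_kernel e)).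
have j0 z : (ker_incl (cover_map i) (ker_incl (diff cover_kernel e) z)).1 = 0.
  by have /(congr1 (ker_incl _)) [] := ker_inclK z.
have jE z : ker_incl (cover_map i) (ker_incl (diff cover_kernel e) z) = (0, j z).
  by rewrite [LHS]surjective_pairing j0.
exists j, s; split.
- move=> x y xy; apply/ker_incl_inj/ker_incl_inj.
  by rewrite !jE xy.
- move=> b; split=> [sb|[z <-]]; last first.
    apply: ker_incl_inj; rewrite raddf0 ker_incl_corestrict.
    rewrite -(ker_inclK (ker_incl (diff cover_kernel e) z)) jE.
    by rewrite /cover_map /= raddf0 add0r.
  have /ker_incl_exact[k kE] : cover_map i (0, b) = 0.
    rewrite /cover_map /= raddf0 add0r.
    by move/(congr1 (ker_incl _)): sb.
  have /ker_incl_exact[z zE] : diff cover_kernel e k = 0.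
    have dk : disk_diff P (ker_incl (cover_map i) k) = 0 by rewrite kE.
    by apply: ker_incl_inj; rewrite raddf0; exact: dk.
  by exists z; have := jE z; rewrite zE kE => -[].
- move=> v; have /(aF (i + 1) i (i - 1) erefl e)[x xE] := ker_inclK v.
  have [b bE] := gS x.
  by exists b; apply: ker_incl_inj; rewrite -xE -bE.
Qed.

End Cover.

(** * Assembling the resolution *)

Section Assemble.
Variable R : pzRingType.

Lemma resolution_trivial (M : lmodType R) :
  exists (X : nat -> lmodType R) (d : forall k, {linear X k.+1 -> X k})
         (e : {linear X 0%N -> M}), resolution 0 d e /\ X 0%N = M.
Proof.
pose X k : lmodType R := if k is 0 then M else 'M[R]_(0, 0).
exists X, (fun k => \0), idfun; split=> //; split.
- by move=> y; exists y.
- by move=> y; split=> /= [->|[x <-]] //; exists 0.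
- move=> k y; split=> // _; exists 0; exact/esym/flatmx0.
- by case=> // k _ x; exact: flatmx0.
Qed.

Lemma resolution_prepend n (K Q M : lmodType R) (j : {linear K -> Q})
    (s : {linear Q -> M}) (X : nat -> lmodType R)
    (d : forall k, {linear X k.+1 -> X k}) (e : {linear X 0%N -> K}) :
  short_exact j s -> resolution n d e ->
  let X' k := if k is l.+1 then X l else Q in
  exists d' : forall k, {linear X' k.+1 -> X' k}, resolution n.+1 d' s.
Proof.
move=> [jI js sS] [eS de dd X0] X'.
pose d' k : {linear X' k.+1 -> X' k} :=
  match k return {linear X' k.+1 -> X' k} with
  | 0 => j \o e
  | l.+1 => d l
  end.
exists d'; split=> //.
- move=> y; split=> [/js[x <-]|[x <-]]; last by apply/js; exists (e x).
  by have [z <-] := eS x; exists z.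
- case=> [|k] /=; last exact: dd.
  move=> y; split=> [ey|[x <-]].
    by apply/de/jI; rewrite raddf0.
  by rewrite /= (de (d 0%N x)).2 ?raddf0 //; exists x.
- by case.
Qed.

Lemma is_PGF_cycles (F : complex R) i :
  F_totally_acyclic F -> (forall k, is_projective (F k)) ->
  is_PGF (cycles F i).
Proof.
move=> [_ aF tF] pF; exists F; split=> //; exists i, idfun.
by exists id.
Qed.

(** Replacing [F] by [cover_kernel] trades one unit of projective dimension for one
    projective term of the resolution; at [p = 0] all [F i] are projective and the
    cycle itself is PGF. *)
Lemma cycles_resolution p (F : complex R) :
  F_totally_acyclic F -> (forall i, pd_le p (F i)) ->
  forall i, exists (X : nat -> lmodType R) (d : forall k, {linear X k.+1 -> X k})
                   (e : {linear X 0%N -> cycles F i}),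
    [/\ resolution p d e, is_PGF (X p)
      & forall j : nat, (j < p)%N -> is_projective (X j)].
Proof.
elim: p F => [|p IHp] F tF pF i.
  have [X [d [e [res X0]]]] := resolution_trivial (cycles F i).
  by exists X, d, e; split; rewrite ?X0 //; exact: is_PGF_cycles.
have [P [pP _ cover]] := common_free_cover F.
pose g k := sval (cid (cover k)).
have gS k : surjective (g k) := svalP (cid (cover k)).
have tK := cover_kernel_F_totally_acyclic gS pP tF.
have pK k : pd_le p (cover_kernel g k).
  exact: pF (projective_prod pP pP) (cover_short_exact gS k).
have [_ aF _] := tF.
have [j [s js]] := cover_cycles gS i aF.
have [X [d [e [res XP Xp]]]] := IHp _ tK pK i.
have [d' res'] := resolution_prepend js res.
exists (fun k => if k is l.+1 then X l else P), d', s; split=> //.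
by case=> [|k] //; exact: Xp.
Qed.

End Assemble.

Theorem lemma4p1 (R : pzRingType) (p : nat) (F : complex R) :
  F_totally_acyclic F ->
  (forall i : int, dim_le (pd (F i)) p) ->
  (forall i : int, dim_le (PGF_dim (cycles F i)) p) /\
  (forall i : int,
     exists (X : nat -> lmodType R)
            (d : forall k : nat, {linear X k.+1 -> X k})
            (e : {linear X 0%N -> cycles F i}),
       [/\ resolution p d e,
           is_PGF (X p)
         & forall j : nat, (j < p)%N -> is_projective (X j)]).
Proof.
move=> tF pF.
have res := cycles_resolution tF (fun i => dim_le_pd_le (pF i)).
split=> // i; apply/dim_le_leastP; exists p => //.
have [X [d [e [resX XP Xp]]]] := res i.
exists X, d, e; split=> // k; rewrite leq_eqVlt => /predU1P[->//|/Xp].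
exact: projective_PGF.
Qed.
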